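(* Let $m\ge 2$, $n\ge 1$, let $\mathcal{A}=(a_{i_1\cdots i_m})\in T_{m,n}$ be strictly semi-positive, let $q\in\mathbb{R}^n$, and let $x$ be a solution of TCP$(\mathcal{A},q)$. If $\mathcal{A}$ is symmetric and $m$ is even, then $$\frac{\|(-q)_+\|_m}{\left(\sum\limits_{i=1}^{n}\left(\sum\limits_{i_2,\dots,i_m=1}^{n}|a_{ii_2\cdots i_m}|\right)^{\frac{m}{m-1}}\right)^{\frac{m-1}{m}}}\le\|x\|_m^{m-1}\le\frac{\|(-q)_+\|_{\frac{m}{m-1}}}{\lambda(\mathcal{A})}.$$
   Context: $T_{m,n}$ is the set of real tensors $\mathcal{A}=(a_{i_1\cdots i_m})$ of order $m$ and dimension $n$, with indices in $I_n=\{1,\dots,n\}$. $\mathcal{A}$ is symmetric if its entries are invariant under any permutation of the indices. For $x\in\mathbb{R}^n$, $\mathcal{A}x^{m-1}\in\mathbb{R}^n$ has components $(\mathcal{A}x^{m-1})_i=\sum_{i_2,\dots,i_m=1}^n a_{ii_2\cdots i_m}x_{i_2}\cdots x_{i_m}$, $\mathcal{A}x^m=x^\top(\mathcal{A}x^{m-1})$, and $x^{[m-1]}=(x_1^{m-1},\dots,x_n^{m-1})^\top$. Inequalities between vectors are componentwise. $\mathcal{A}$ is strictly semi-positive if for each $x\ge 0$, $x\ne 0$, there is $k\in I_n$ with $x_k>0$ and $(\mathcal{A}x^{m-1})_k>0$. A solution of the tensor complementarity problem TCP$(\mathcal{A},q)$ is a vector $x\in\mathbb{R}^n$ with $x\ge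 0$, $q+\mathcal{A}x^{m-1}\ge 0$ and $x^\top(q+\mathcal{A}x^{m-1})=0$. $x_+=(\max\{x_1,0\},\dots,\max\{x_n,0\})^\top$ and $\|x\|_p=(\sum_i|x_i|^p)^{1/p}$ for $p\ge 1$. A real number $\mu$ is a Pareto $H$-eigenvalue of $\mathcal{A}$ if there is a nonzero $x\in\mathbb{R}^n$ with $\mathcal{A}x^m=\mu x^\top x^{[m-1]}$, $\mathcal{A}x^{m-1}-\mu x^{[m-1]}\ge 0$ and $x\ge 0$. $\lambda(\mathcal{A})$ denotes the smallest Pareto $H$-eigenvalue of $\mathcal{A}$. *)

(* Defs.v *)
From HB Require Import structures.
From mathcomp Require Import all_boot all_order all_algebra all_fingroup.
From mathcomp Require Import all_classical all_reals all_analysis.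

Set Implicit Arguments.
Unset Strict Implicit.
Unset Printing Implicit Defensive.
Import Order.TTheory GRing.Theory Num.Theory.

Local Open Scope classical_set_scope.
Local Open Scope ring_scope.

(* Indices run over 'I_n = {0, ..., n - 1}; a multi-index (i_1, ..., i_m) is  *)
(* an m.-tuple.                                                               *)
Definition tensor (R : realType) (m n : nat) := m.-tuple 'I_n -> R.

Definition tensor_symmetric (R : realType) (m n : nat) (A : tensor R m n) :=
  forall (s : 'S_m) (J : m.-tuple 'I_n), A [tuple tnth J (s k) | k < m] = A J.

(* A x^(m-1).  The multi-indices J with first entry i are exactly the         *)
(* (i, i_2, ..., i_m), and behead J is then (i_2, ..., i_m); summing over J   *)
(* rather than over (m-1)-tuples avoids a cast between m and m.-1.+1.         *)
Definition tensor_app (R : realType) (m n : nat) (A : tensor R m n)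
    (x : 'cV[R]_n) : 'cV[R]_n :=
  \col_i \sum_(J : m.-tuple 'I_n | ohead J == Some i)
           A J * \prod_(j <- behead J) x j 0.

Definition dotv (R : realType) (n : nat) (x y : 'cV[R]_n) : R :=
  (x^T *m y) 0 0.

(* A x^m *)
Definition tensor_form (R : realType) (m n : nat) (A : tensor R m n)
    (x : 'cV[R]_n) : R := dotv x (tensor_app A x).

(* x^[k] *)
Definition hadamard_pow (R : realType) (n : nat) (x : 'cV[R]_n) (k : nat) :
  'cV[R]_n := \col_i x i 0 ^+ k.

Definition vec_ge0 (R : realType) (n : nat) (x : 'cV[R]_n) : Prop :=
  forall i, 0 <= x i 0.

Definition pos_part (R : realType) (n : nat) (x : 'cV[R]_n) : 'cV[R]_n :=
  \col_i Num.max (x i 0) 0.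

(* Meant for p >= 1. *)
Definition pnorm (R : realType) (n : nat) (p : R) (x : 'cV[R]_n) : R :=
  (\sum_i `|x i 0| `^ p) `^ p^-1.

Definition strictly_semi_positive (R : realType) (m n : nat)
    (A : tensor R m n) : Prop :=
  forall x : 'cV[R]_n, vec_ge0 x -> x <> 0 ->
    exists k : 'I_n, 0 < x k 0 /\ 0 < tensor_app A x k 0.

Definition TCP_solution (R : realType) (m n : nat) (A : tensor R m n)
    (q x : 'cV[R]_n) : Prop :=
  [/\ vec_ge0 x, vec_ge0 (q + tensor_app A x)
    & dotv x (q + tensor_app A x) = 0].

Definition pareto_H_eigenvalue (R : realType) (m n : nat) (A : tensor R m n)
    (mu : R) : Prop :=
  exists x : 'cV[R]_n,
    [/\ x <> 0,
        tensor_form A x = mu * dotv x (hadamard_pow x m.-1),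
        vec_ge0 (tensor_app A x - mu *: hadamard_pow x m.-1)
      & vec_ge0 x].

Definition smallest_pareto_H_eigenvalue (R : realType) (m n : nat)
    (A : tensor R m n) (mu : R) : Prop :=
  pareto_H_eigenvalue A mu /\
  forall nu, pareto_H_eigenvalue A nu -> mu <= nu.

(* lambda(A); the default value 0 is taken only when there is no smallest     *)
(* Pareto H-eigenvalue.                                                       *)
Definition pareto_H_lambda (R : realType) (m n : nat) (A : tensor R m n) : R :=
  xget 0 [set mu | smallest_pareto_H_eigenvalue A mu].

(* Main.v *)
(* Lower bound: feasibility gives -q <= A x^(m-1), whose i-th entry is at most
   the i-th absolute row sum of A times |x|_m^(m-1), and |.|_m <= |.|_(m/(m-1))
   because m/(m-1) <= m.

   Upper bound: for symmetric A, lambda(A) is the minimum of A x^m over the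
   nonnegative x with |x|_m = 1, attained by compactness; strict
   semi-positivity makes it positive. Complementarity and Hoelder then give
     lambda(A) |x|_m^m <= A x^m = - x^T q <= |x|_m |(-q)_+|_(m/(m-1)). *)
Require Import Defs.
From HB Require Import structures.
From mathcomp Require Import all_boot all_order all_algebra all_fingroup.
From mathcomp Require Import all_classical all_reals all_analysis.

Set Implicit Arguments.
Unset Strict Implicit.
Unset Printing Implicit Defensive.
Import Order.TTheory GRing.Theory Num.Theory.
Import numFieldNormedType.Exports.
Local Open Scope classical_set_scope.
Local Open Scope ring_scope.

(** * Polynomial derivatives and one-sided first-order conditions *)

Lemma deriv_prod (R : comNzRingType) (I : eqType) (r : seq I)
    (F : I -> {poly R}) :
  uniq r ->
  (\prod_(k <- r) F k)^`() =
    \sum_(k <- r) (F k)^`() * \prod_(l <- r | l != k) F l.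
Proof.
elim: r => [_|k0 r IHr /= /andP[k0r /IHr IH]].
  by rewrite !big_nil -polyC1 derivC.
(* As [k0] does not recur in [r], filtering by value removes exactly one factor. *)
have neq_k0 l : l \in r -> l != k0 by apply: contraTneq => ->.
rewrite !big_cons derivM IH eqxx /=; congr (_ * _ + _).
  rewrite big_seq [RHS]big_seq_cond; apply: eq_bigl => l.
  by rewrite andb_idr// => /neq_k0.
rewrite mulr_sumr; apply: eq_big_seq => k kr.
by rewrite big_cons eq_sym neq_k0// mulrCA.
Qed.

(** Factoring [p] as [r * 'X] gives derivative [r.[0]] at 0, the limit from the right of the
    quotients p(t) / t, which are nonnegative. *)
Lemma deriv_ge0_at_root (R : realType) (p : {poly R}) :
  p.[0] = 0 -> (forall t, 0 < t -> 0 <= p.[t]) -> 0 <= p^`().[0].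
Proof.
move=> /eqP/factor_theorem[r ->] p_ge0.
rewrite derivM derivXsubC hornerD !hornerM hornerXsubC subrr mulr0 add0r.
rewrite hornerC mulr1.
have r0 : r.[x] @[x --> 0^'+] --> r.[0].
  by apply: cvg_at_right_filter; exact: continuous_horner.
apply: (cvgr_to_ge r0); near=> t.
have t0 : 0 < t by near: t; exact: nbhs_right_gt.
by move: (p_ge0 _ t0); rewrite hornerM hornerXsubC subr0 pmulr_lge0.
Unshelve. all: by end_near. Qed.

(** * Tensor expressions as sums over multi-indices, and the gradient of the form *)

Lemma dotvE (R : realType) (n : nat) (x y : 'cV[R]_n) :
  dotv x y = \sum_i x i 0 * y i 0.
Proof. by rewrite /dotv mxE; apply: eq_bigr => i _; rewrite mxE. Qed.

(** Turning the condition on the first entry into an indicator puts position [ord0] on the same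
    footing as any other position [k]. *)
Lemma tensor_appE (R : realType) (m n : nat) (A : tensor R m.+1 n)
    (x : 'cV[R]_n) (i : 'I_n) :
  tensor_app A x i 0 =
    \sum_(J : m.+1.-tuple 'I_n)
       A J * ((tnth J ord0 == i)%:R * \prod_(l | l != ord0) x (tnth J l) 0).
Proof.
rewrite mxE big_mkcond; apply: eq_bigr => J _.
case/tupleP: J => j J; rewrite /= tnth0 (inj_eq Some_inj).
case: eqP => _; last by rewrite mul0r mulr0.
rewrite mul1r big_tuple [in RHS]big_mkcond big_ord_recl /= mul1r.
by congr (_ * _); apply: eq_bigr => l _; rewrite tnthS.
Qed.

Lemma tensor_formE (R : realType) (m n : nat) (A : tensor R m.+1 n)
    (x : 'cV[R]_n) :
  tensor_form A x =
    \sum_(J : m.+1.-tuple 'I_n) A J * \prod_l x (tnth J l) 0.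
Proof.
rewrite /tensor_form dotvE.
under eq_bigr do rewrite tensor_appE mulr_sumr.
rewrite exchange_big; apply: eq_bigr => J _.
rewrite (bigD1 (tnth J ord0)) //= eqxx [X in _ + X]big1 => [|i /negPf].
  by rewrite addr0 mul1r mulrCA [in RHS](bigD1 ord0).
by rewrite eq_sym => ->; rewrite mul0r !mulr0.
Qed.

(** Swapping positions [ord0] and [k] is an involution on multi-indices that leaves the entries of
    [A] unchanged. *)
Lemma tensor_app_perm (R : realType) (m n : nat) (A : tensor R m.+1 n)
    (x : 'cV[R]_n) (i : 'I_n) (k : 'I_m.+1) : tensor_symmetric A ->
  \sum_(J : m.+1.-tuple 'I_n)
     A J * ((tnth J k == i)%:R * \prod_(l | l != k) x (tnth J l) 0) =
  tensor_app A x i 0.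
Proof.
move=> symA; rewrite tensor_appE; pose s := tperm ord0 k.
pose sJ (J : m.+1.-tuple 'I_n) := [tuple tnth J (s l) | l < m.+1].
have sJK : involutive sJ.
  by move=> J; apply: eq_from_tnth => l; rewrite !tnth_mktuple tpermK.
rewrite [RHS](reindex_inj (inv_inj sJK)); apply: eq_bigr => J _.
rewrite symA tnth_mktuple tpermL; congr (_ * (_ * _)).
rewrite (reindex_inj (@perm_inj _ s)); apply: eq_big => l; last first.
  by rewrite tnth_mktuple.
by rewrite -{1}(tpermL ord0 k) (inj_eq perm_inj).
Qed.

(* The difference of the two sides of the hypothesis on mu is nonnegative on
   the orthant and vanishes at x, so its derivative at x along each basis
   vector is nonnegative; by symmetry this derivative is m + 1 times the
   corresponding entry of the conclusion. *)
Lemma min_form_gradient_ge0 (R : realType) (m n : nat) (A : tensor R m.+1 n)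
    (mu : R) (x : 'cV[R]_n) : tensor_symmetric A ->
  (forall y, vec_ge0 y -> mu * \sum_i y i 0 ^+ m.+1 <= tensor_form A y) ->
  vec_ge0 x -> tensor_form A x = mu * \sum_i x i 0 ^+ m.+1 ->
  vec_ge0 (tensor_app A x - mu *: hadamard_pow x m).
Proof.
move=> symA muP x0 Ax i.
pose v (j : 'I_n) : {poly R} := (x j 0)%:P + (j == i)%:R%:P * 'X.
pose p : {poly R} :=
  \sum_(J : m.+1.-tuple 'I_n) (A J)%:P * \prod_l v (tnth J l)
    - mu%:P * \sum_j v j ^+ m.+1.
have vE t j : (v j).[t] = (x + t *: delta_mx i 0) j 0.
  by rewrite !hornerE !mxE eqxx andbT mulrC.
have v0 j : (v j).[0] = x j 0 by rewrite vE scale0r addr0.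
have v' j : (v j)^`() = (j == i)%:R%:P.
  by rewrite derivD derivM !derivC derivX mul0r mulr1 !add0r.
have pE t : p.[t] = let y := x + t *: delta_mx i 0 in
    tensor_form A y - mu * \sum_j y j 0 ^+ m.+1.
  rewrite /p /= tensor_formE !hornerE !horner_sum; congr (_ - _ * _).
    apply: eq_bigr => J _; rewrite !hornerE horner_prod.
    by congr (_ * _); apply: eq_bigr => l _; rewrite vE.
  by apply: eq_bigr => j _; rewrite horner_exp vE.
have p'E : p^`().[0] = m.+1%:R * (tensor_app A x i 0 - mu * x i 0 ^+ m).
  rewrite /p derivB derivM derivC mul0r add0r !(raddf_sum (@deriv R)) /=.
  rewrite hornerD hornerN hornerM hornerC !horner_sum mulrBr mulrCA.
  congr (_ - _ * _).
    (* The Leibniz rule gives one sum per position [k]; by symmetry all of them are equal, whence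
       the factor [m.+1]. *)
    transitivity (\sum_(k < m.+1) \sum_(J : m.+1.-tuple 'I_n)
        A J * ((tnth J k == i)%:R * \prod_(l | l != k) x (tnth J l) 0)).
      rewrite exchange_big; apply: eq_bigr => J _.
      rewrite derivM derivC mul0r add0r deriv_prod ?index_enum_uniq//.
      rewrite hornerM hornerC horner_sum mulr_sumr; apply: eq_bigr => k _.
      rewrite v' hornerM hornerC horner_prod; congr (_ * (_ * _)).
      by apply: eq_bigr => l _; rewrite v0.
    rewrite (eq_bigr (fun=> tensor_app A x i 0)) => [|k _].
      by rewrite sumr_const card_ord mulr_natl.
    exact: tensor_app_perm.
  rewrite (bigD1 i)//= big1 => [|j /negPf ji]; last first.
    by rewrite deriv_exp v' ji mul0r mul0rn horner0.
  by rewrite addr0 deriv_exp v' eqxx mul1r hornerMn horner_exp v0 mulr_natl.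
have := @deriv_ge0_at_root _ p; rewrite p'E pmulr_rge0 ?ltr0Sn// !mxE; apply.
  by rewrite pE /= scale0r addr0 Ax subrr.
move=> t t0; rewrite pE /= subr_ge0; apply: muP => j.
by rewrite !mxE addr_ge0// mulr_ge0// ltW.
Qed.

(** * Minimum of the form on the orthant, and positivity of Pareto H-eigenvalues *)

Lemma dotv_hadamard_pow (R : realType) (m n : nat) (x : 'cV[R]_n) :
  dotv x (hadamard_pow x m) = \sum_i x i 0 ^+ m.+1.
Proof. by rewrite dotvE; apply: eq_bigr => i _; rewrite mxE exprS. Qed.

Lemma tensor_formZ (R : realType) (m n : nat) (A : tensor R m.+1 n) (c : R)
    (x : 'cV[R]_n) : tensor_form A (c *: x) = c ^+ m.+1 * tensor_form A x.
Proof.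
rewrite !tensor_formE mulr_sumr; apply: eq_bigr => J _; rewrite mulrCA.
under eq_bigr do rewrite mxE.
by rewrite big_split prodr_const card_ord.
Qed.

(** The constraint set is a closed part of the cube [0, 1]^n, hence compact, and it contains the
    basis vectors. Points are handled as row vectors, to which [rV_compact] applies, and
    transposed. *)
Lemma tensor_form_min (R : realType) (m n : nat) (A : tensor R m.+1 n) :
  (0 < n)%N -> exists x : 'cV[R]_n,
    [/\ vec_ge0 x, \sum_i x i 0 ^+ m.+1 = 1
      & forall y, vec_ge0 y -> \sum_i y i 0 ^+ m.+1 = 1 ->
          tensor_form A x <= tensor_form A y].
Proof.
move=> n0; pose box :=
  [set v : 'rV[R]_n | forall i, `[0, 1]%classic (v ord0 i)].
pose N (v : 'rV[R]_n) := \sum_i v 0 i ^+ m.+1.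
pose S := box `&` N @^-1` [set 1].
have box_compact : compact box.
  by apply: (@rV_compact R n (fun=> `[0, 1]%classic)) => i;
    exact: segment_compact.
have N_continuous : continuous N.
  apply: continuous_big; first exact: add_continuous.
  move=> i _ v; apply: (continuous_comp (f := fun v : 'rV[R]_n => v 0 i)
    (g := fun r : R => r ^+ m.+1)).
    exact: coord_continuous.
  exact: exprn_continuous.
have S_compact : compact S.
  apply: compact_closedI => //.
  by apply: preimage_closed; [move=> v _; exact: N_continuous|exact: closed_eq].
have S_nonempty : S !=set0.
  exists (delta_mx 0 (Ordinal n0)); split=> [i|] /=.
    by rewrite !mxE in_itv /= ler0n lern1 leq_b1.
  rewrite /N (bigD1 (Ordinal n0))//= big1 => [|i /negPf ni].
    by rewrite mxE !eqxx expr1n addr0.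
  by rewrite mxE ni andbF expr0n.
have form_continuous : continuous (fun v : 'rV[R]_n => tensor_form A v^T).
  under eq_fun do rewrite tensor_formE.
  apply: continuous_big => [|J _]; first exact: add_continuous.
  have prod_continuous :
      continuous (fun v : 'rV[R]_n => \prod_l v^T (tnth J l) 0).
    apply: continuous_big => [|l _]; first exact: mul_continuous.
    by under eq_fun do rewrite mxE; exact: coord_continuous.
  by move=> v; apply: continuousM; [exact: cst_continuous|
    exact: prod_continuous].
have [v] := compact_EVT_min S_nonempty S_compact
  (continuous_subspaceT form_continuous).
rewrite inE => -[v01 Nv] v_min; exists v^T; split => [i||y y0 Ny].
- by rewrite mxE; have := v01 i; rewrite /= in_itv /= => /andP[].
- by rewrite -Nv; apply: eq_bigr => i _; rewrite mxE.
rewrite -(trmxK y); apply: v_min; rewrite inE; split=> [i|] /=; last first.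
  by rewrite -Ny; apply: eq_bigr => i _; rewrite mxE.
(* Membership in the cube is automatic: each power is at most the whole sum, which is 1. *)
rewrite mxE in_itv /= y0 /= -(@expr_le1 _ m.+1)// -Ny (bigD1 i)//= lerDl.
by apply: sumr_ge0 => j _; exact: exprn_ge0.
Qed.

(* The minimum mu of A x^m over the points of the orthant with sum x_i^m = 1 is
   a Pareto H-eigenvalue by first-order optimality, and it bounds the others
   from below by homogeneity; so it is lambda(A). *)
Lemma pareto_H_lambda_spec (R : realType) (m n : nat) (A : tensor R m.+1 n) :
  (0 < n)%N -> tensor_symmetric A ->
  pareto_H_eigenvalue A (pareto_H_lambda A) /\
  forall y, vec_ge0 y ->
    pareto_H_lambda A * \sum_i y i 0 ^+ m.+1 <= tensor_form A y.
Proof.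
move=> n0 symA; have [x [x0 Nx x_min]] := tensor_form_min A n0.
pose mu := tensor_form A x.
have muP y : vec_ge0 y -> mu * \sum_i y i 0 ^+ m.+1 <= tensor_form A y.
  move=> y0; pose s := \sum_i y i 0 ^+ m.+1.
  have s_ge0 : 0 <= s by apply: sumr_ge0 => i _; exact: exprn_ge0.
  (* If [s] vanishes then [y] is 0 and cannot be normalized, but both sides are 0. *)
  have [s0|s_neq0] := eqVneq s 0.
    have y_eq0 : y = 0.
      apply/colP => i; rewrite mxE; apply/eqP; move/eqP: s0.
      rewrite psumr_eq0 => [/allP/(_ i)|j _]; last exact: exprn_ge0.
      by rewrite mem_index_enum expf_eq0 /= => /(_ isT).
    rewrite -/s s0 mulr0 y_eq0 -[X in tensor_form A X](scale0r 0) tensor_formZ.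
    by rewrite expr0n mul0r.
  have s_gt0 : 0 < s by rewrite lt_def s_neq0.
  (* [c] is the norm of [y], so [c^-1 *: y] satisfies the constraint. *)
  pose c := s `^ (m.+1%:R)^-1.
  have c_gt0 : 0 < c by exact: powR_gt0.
  have cs : c ^+ m.+1 = s.
    by rewrite -powR_mulrn ?ltW// -powRrM mulVf ?pnatr_eq0// powRr1.
  have := x_min (c^-1 *: y).
  rewrite tensor_formZ exprVn cs mulrC ler_pdivlMr//; apply.
    by move=> i; rewrite mxE mulr_ge0// invr_ge0 ltW.
  under eq_bigr do rewrite mxE exprMn exprVn cs.
  by rewrite -mulr_sumr mulVf.
have mu_eig : pareto_H_eigenvalue A mu.
  exists x; rewrite dotv_hadamard_pow Nx mulr1; split=> //.
    move=> x_eq0; move/eqP: Nx; rewrite x_eq0 big1 => [|i _].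
      by rewrite eq_sym oner_eq0.
    by rewrite mxE expr0n.
  by apply: min_form_gradient_ge0 => //; rewrite Nx mulr1.
have mu_le nu : pareto_H_eigenvalue A nu -> mu <= nu.
  move=> [y [y_neq0 Ay _ y0]]; have := muP _ y0; rewrite Ay dotv_hadamard_pow.
  rewrite ler_pM2r// lt_def sumr_ge0 ?andbT => [|i _]; last exact: exprn_ge0.
  apply/eqP => /eqP; rewrite psumr_eq0 => [/allP ys|j _]; last exact: exprn_ge0.
  apply: y_neq0; apply/colP => i; rewrite mxE; apply/eqP.
  by have := ys i (mem_index_enum i); rewrite expf_eq0.
(* [mu] witnesses that a smallest eigenvalue exists, so [xget] does not return its default. *)
have [lam_eig lam_le] : smallest_pareto_H_eigenvalue A (pareto_H_lambda A).
  by apply: (xgetPex (P := smallest_pareto_H_eigenvalue A) 0); exists mu.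
suff -> : pareto_H_lambda A = mu by [].
by apply/eqP; rewrite eq_le lam_le// mu_le.
Qed.

(** The complementarity terms are nonnegative with sum 0, so each vanishes. At the index [k] given
    by strict semi-positivity this makes [mu * x k 0 ^+ m] equal to a positive number. *)
Lemma pareto_H_eigenvalue_gt0 (R : realType) (m n : nat) (A : tensor R m.+1 n)
    (mu : R) :
  strictly_semi_positive A -> pareto_H_eigenvalue A mu -> 0 < mu.
Proof.
move=> hA [x [x_neq0 Ax grad_ge0 x0]].
have slack_ge0 i : 0 <= x i 0 * (tensor_app A x i 0 - mu * x i 0 ^+ m).
  by rewrite mulr_ge0//; have := grad_ge0 i; rewrite !mxE.
have slack_sum :
    \sum_i x i 0 * (tensor_app A x i 0 - mu * x i 0 ^+ m) = 0.
  move/eqP: Ax; rewrite /tensor_form !dotvE -subr_eq0 mulr_sumr -sumrB.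
  move=> /eqP Ax; rewrite -[RHS]Ax; apply: eq_bigr => i _.
  by rewrite mulrBr; congr (_ - _); rewrite mxE mulrCA.
have [k [xk Axk]] := hA x x0 x_neq0.
move/eqP: slack_sum; rewrite psumr_eq0// => /allP/(_ k (mem_index_enum k)).
rewrite mulf_eq0 gt_eqF//= subr_eq0 => /eqP Axk_eq; move: Axk.
by rewrite Axk_eq pmulr_lgt0// exprn_gt0.
Qed.

(** * Hoelder's inequality and p-norms *)

Lemma sum_powR_ge0 (R : realType) (I : Type) (r : seq I) (P : pred I)
    (f : I -> R) (p : R) : 0 <= \sum_(i <- r | P i) f i `^ p.
Proof. by apply: sumr_ge0 => i _; exact: powR_ge0. Qed.

Lemma hoelder_sum (R : realType) (I : Type) (r : seq I) (a b : I -> R)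
    (p q : R) : 0 < p -> 0 < q -> p^-1 + q^-1 = 1 ->
  (forall i, 0 <= a i) -> (forall i, 0 <= b i) ->
  \sum_(i <- r) a i * b i <=
    (\sum_(i <- r) a i `^ p) `^ p^-1 * (\sum_(i <- r) b i `^ q) `^ q^-1.
Proof.
move=> p0 q0 pq a0 b0; elim: r => [|i r IHr].
  by rewrite !big_nil mulr_ge0// powR_ge0.
rewrite !big_cons (le_trans (lerD (lexx _) IHr))//.
have powK (f : I -> R) s : 0 < s ->
    ((\sum_(j <- r) f j `^ s) `^ s^-1) `^ s = \sum_(j <- r) f j `^ s.
  by move=> s0; rewrite -powRrM mulVf ?gt_eqF// powRr1// sum_powR_ge0.
(* Two-term Hoelder, applied to the head entries and the norms of the tails. *)
by rewrite -[in leRHS](powK a p)// -[in leRHS](powK b q)// hoelder2// powR_ge0.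
Qed.

Lemma pnorm_ge0 (R : realType) (n : nat) (p : R) (x : 'cV[R]_n) :
  0 <= pnorm p x.
Proof. exact: powR_ge0. Qed.

Lemma powR_pnorm (R : realType) (n : nat) (p : R) (x : 'cV[R]_n) :
  0 < p -> pnorm p x `^ p = \sum_i `|x i 0| `^ p.
Proof.
by move=> p0; rewrite -powRrM mulVf ?gt_eqF// powRr1// sum_powR_ge0.
Qed.

Lemma ler_coord_pnorm (R : realType) (n : nat) (p : R) (x : 'cV[R]_n) i :
  0 < p -> `|x i 0| <= pnorm p x.
Proof.
move=> p0; have -> : `|x i 0| = (`|x i 0| `^ p) `^ p^-1.
  by rewrite -powRrM mulfV ?gt_eqF// powRr1.
rewrite ge0_ler_powR ?invr_ge0 ?(ltW p0)// ?nnegrE ?powR_ge0 ?sum_powR_ge0//.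
by rewrite (bigD1 i)//= lerDl sum_powR_ge0.
Qed.

Lemma ler_pnorm (R : realType) (n : nat) (p : R) (x y : 'cV[R]_n) :
  0 < p -> (forall i, `|x i 0| <= `|y i 0|) -> pnorm p x <= pnorm p y.
Proof.
move=> p0 xy.
rewrite ge0_ler_powR ?invr_ge0 ?(ltW p0) ?nnegrE ?sum_powR_ge0//.
by apply: ler_sum => i _; rewrite ge0_ler_powR ?(ltW p0) ?nnegrE.
Qed.

Lemma pnormZ (R : realType) (n : nat) (p c : R) (x : 'cV[R]_n) :
  0 < p -> pnorm p (c *: x) = `|c| * pnorm p x.
Proof.
move=> p0; rewrite /pnorm.
under eq_bigr do rewrite mxE normrM powRM//.
rewrite -mulr_sumr powRM ?powR_ge0 ?sum_powR_ge0//.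
by rewrite -powRrM mulfV ?gt_eqF// powRr1.
Qed.

Lemma pnorm0 (R : realType) (n : nat) (p : R) :
  p != 0 -> pnorm p (0 : 'cV[R]_n) = 0.
Proof.
move=> p0; rewrite /pnorm big1 ?powR0 ?invr_eq0// => i _.
by rewrite mxE normr0 powR0.
Qed.

(* With N = |x|_p, every |x_i| <= N, so |x_i|^r <= |x_i|^p N^(r - p). *)
Lemma pnorm_anti (R : realType) (n : nat) (p r : R) (x : 'cV[R]_n) :
  0 < p -> p <= r -> pnorm r x <= pnorm p x.
Proof.
move=> p0 pr; have r0 := lt_le_trans p0 pr.
have [x0|N_neq0] := eqVneq (pnorm p x) 0.
  have -> : x = 0.
    apply/colP => i; rewrite mxE; apply/eqP; rewrite -normr_le0 -x0.
    exact: ler_coord_pnorm.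
  by rewrite !pnorm0 ?lt0r_neq0.
have N0 : 0 < pnorm p x by rewrite lt_def N_neq0 pnorm_ge0.
(* Writing the right side as (N^r)^(1/r) reduces the claim to a comparison of r-th powers. *)
rewrite -[leRHS](powRr1 (pnorm_ge0 _ _)) -(mulfV (lt0r_neq0 r0)) powRrM.
rewrite ge0_ler_powR ?invr_ge0 ?nnegrE ?(ltW r0) ?powR_ge0 ?sum_powR_ge0//.
(* This covers [t = 0] too, because the total exponent [r] is nonzero. *)
have split_r (t : R) : 0 <= t -> t `^ r = t `^ p * t `^ (r - p).
  move=> t0; rewrite -powRD ?(addrC p) ?subrK//.
  by rewrite gt_eqF.
rewrite (split_r _ (pnorm_ge0 _ _)) powR_pnorm// mulr_suml.
apply: ler_sum => i _; rewrite split_r// ler_wpM2l ?powR_ge0//.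
by rewrite ge0_ler_powR ?subr_ge0 ?nnegrE ?pnorm_ge0// ler_coord_pnorm.
Qed.

Lemma hoelder_pnorm (R : realType) (n : nat) (p q : R) (x y : 'cV[R]_n) :
  0 < p -> 0 < q -> p^-1 + q^-1 = 1 -> dotv x y <= pnorm p x * pnorm q y.
Proof.
move=> p0 q0 pq; rewrite dotvE.
apply: le_trans (@hoelder_sum _ _ (index_enum 'I_n) (fun i => `|x i 0|)
  (fun i => `|y i 0|) p q p0 q0 pq _ _) => //.
by apply: ler_sum => i _; rewrite -normrM ler_norm.
Qed.

(** * Row-sum estimate and the two bounds on the solution *)

Lemma tensor_app_le (R : realType) (m n : nat) (A : tensor R m.+1 n)
    (x : 'cV[R]_n) (c : R) (i : 'I_n) : (forall j, `|x j 0| <= c) ->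
  `|tensor_app A x i 0| <=
    (\sum_(J : m.+1.-tuple 'I_n | ohead J == Some i) `|A J|) * c ^+ m.
Proof.
move=> xc; rewrite mxE (le_trans (ler_norm_sum _ _ _))// mulr_suml.
apply: ler_sum => J _; rewrite normrM ler_wpM2l// normr_prod.
(* Each monomial has [m] factors, all at most [c] in absolute value. *)
have szJ : size (behead J) = m by rewrite size_behead size_tuple.
rewrite -[X in c ^+ X]szJ.
elim: (behead J) => [|j s IHs]; first by rewrite big_nil.
by rewrite big_cons exprS ler_pM// prodr_ge0.
Qed.

Theorem theorem3p15 (R : realType) (m n : nat) (hm : (2 <= m)%N)
  (hn : (1 <= n)%N) (A : tensor R m n) (hA : strictly_semi_positive A)
  (q x : 'cV[R]_n) (hx : TCP_solution A q x)
  (hsym : tensor_symmetric A) (heven : ~~ odd m) :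
  pnorm m%:R (pos_part (- q)) /
    (\sum_(i < n)
       (\sum_(J : m.-tuple 'I_n | ohead J == Some i) `|A J|)
         `^ (m%:R / (m%:R - 1))) `^ ((m%:R - 1) / m%:R)
    <= pnorm m%:R x ^+ m.-1
  /\
  pnorm m%:R x ^+ m.-1
    <= pnorm (m%:R / (m%:R - 1)) (pos_part (- q)) / pareto_H_lambda A.
Proof.
case: m hm A hA hx hsym {heven} => // m m0 A hA [x0 slack0 comp] symA /=.
(* The order of the tensor is now [m.+1]; [p'] is the Hoelder conjugate of [p]. *)
set p : R := m.+1%:R; set p' := p / (p - 1).
have p_gt0 : 0 < p by rewrite ltr0Sn.
have pB1 : p - 1 = m%:R by rewrite /p -natr1 addrK.
have pB1_ge1 : 1 <= p - 1 by rewrite pB1 ler1n.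
have pB1_gt0 : 0 < p - 1 := lt_le_trans ltr01 pB1_ge1.
have p'_gt0 : 0 < p' by rewrite divr_gt0.
have p'V : (p - 1) / p = p'^-1 by rewrite invf_div.
have p'_le : p' <= p by rewrite ler_pdivrMr// ler_peMr// ltW.
have pp' : p^-1 + p'^-1 = 1.
  by rewrite -p'V mulrBl mulfV ?gt_eqF// mul1r addrC subrK.
have posq i : q i 0 + pos_part (- q) i 0 >= 0.
  by rewrite !mxE -lerBlDl sub0r le_max lexx.
split.
  (* The denominator is the [p']-norm of the vector [r] of absolute row sums. *)
  pose r : 'cV[R]_n :=
    \col_i \sum_(J : m.+1.-tuple 'I_n | ohead J == Some i) `|A J|.
  have r0 i : 0 <= r i 0 by rewrite mxE sumr_ge0.
  set D := (\sum_(i < n) _) `^ _.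
  have -> : D = pnorm p' r.
    rewrite /D p'V /pnorm; congr (_ `^ _); apply: eq_bigr => i _.
    by rewrite ger0_norm// mxE.
  (* For a zero denominator the quotient is 0 by convention. *)
  have [->|D0] := eqVneq (pnorm p' r) 0.
    by rewrite invr0 mulr0 exprn_ge0// pnorm_ge0.
  rewrite ler_pdivrMr ?lt_def ?D0 ?pnorm_ge0//.
  apply: le_trans (pnorm_anti _ p'_gt0 p'_le) _.
  have Nm_ge0 : 0 <= pnorm p x ^+ m by rewrite exprn_ge0// pnorm_ge0.
  (* Absorbing the scalar into the norm leaves an entrywise comparison of (-q)_+ with a multiple of
     [r]. *)
  rewrite -[X in X * _](ger0_norm Nm_ge0) -(pnormZ _ _ p'_gt0).
  apply: (ler_pnorm p'_gt0) => i.
  have q_le : (- q) i 0 <= `|tensor_app A x i 0|.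
    have := slack0 i; rewrite [(q + _) i 0]mxE [(- q) i 0]mxE -lerBlDl sub0r.
    by move=> /le_trans; apply; exact: ler_norm.
  rewrite [pos_part _ _ _]mxE ger0_norm ?le_max ?lexx ?orbT// ge_max.
  apply/andP; split => //; apply: le_trans q_le _.
  rewrite [in leRHS]mxE normrM (ger0_norm Nm_ge0) (ger0_norm (r0 i)) mulrC.
  by rewrite [r i 0]mxE; apply: tensor_app_le => j; exact: ler_coord_pnorm.
have [lam_eig lam_le] := pareto_H_lambda_spec hn symA.
have lam_gt0 := pareto_H_eigenvalue_gt0 hA lam_eig.
rewrite ler_pdivlMr// mulrC.
(* A zero norm gives left side 0, since [m] is positive; otherwise both sides are multiplied by the
   norm, to reach the exponent [m.+1]. *)
have [->|N_neq0] := eqVneq (pnorm p x) 0.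
  by rewrite expr0n gtn_eqF// mulr0 pnorm_ge0.
rewrite -(@ler_pM2r _ (pnorm p x)) ?lt_def ?N_neq0 ?pnorm_ge0//.
rewrite -mulrA -exprSr [leRHS]mulrC.
apply: le_trans (hoelder_pnorm _ _ _ _ pp') => //.
apply: (@le_trans _ _ (tensor_form A x)).
  rewrite (le_trans _ (lam_le _ x0))// ler_pM2l//.
  rewrite -powR_mulrn ?pnorm_ge0// powR_pnorm//.
  by apply: ler_sum => i _; rewrite powR_mulrn// ger0_norm.
rewrite -subr_ge0.
(* Adding the vanishing complementarity product cancels the form and leaves x^T (q + (-q)_+), whose
   terms are nonnegative. *)
have -> : dotv x (pos_part (- q)) - tensor_form A x =
    \sum_i x i 0 * (q i 0 + pos_part (- q) i 0).
  rewrite -[LHS]addr0 -[X in _ + X]comp /tensor_form !dotvE -sumrB -big_split.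
  apply: eq_bigr => i _ /=; rewrite [(q + _) i 0]mxE mulrDr (addrC (_ * q i 0)).
  by rewrite addrA subrK addrC -mulrDr.
by apply: sumr_ge0 => i _; rewrite mulr_ge0.
Qed.
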